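(* Let $a,d,k$ be positive integers with $\gcd(a,d)=1$ and $2\le k\le a$. Let $q$ and $r$ be nonnegative integers with $a-1=q(k-1)+r$ and $0\le r<k-1$. Let $\lambda$ be a complex number with $\lambda\ne 0$, $\lambda^{a}=1$ and $\lambda^d\ne 1$. Then for every positive integer $\mu$, $$ \begin{aligned} &s_\mu^{(\lambda)}(a,a+d,\dots,a+(k-1)d)\\ &=\frac{1}{\mu+1}\sum_{n=0}^\mu\binom{\mu+1}{n}B_n a^{n-1}\sum_{\ell=0}^{\mu+1-n}\binom{\mu+1-n}{\ell}d^\ell\\ &\qquad\times\biggl(\sum_{s=1}^q(sa)^{\mu+1-n-\ell}\sum_{j=(s-1)(k-1)+1}^{s(k-1)}D_{j,\ell}+\bigl((q+1)a\bigr)^{\mu+1-n-\ell}\sum_{j=q(k-1)+1}^{q(k-1)+r}D_{j,\ell}\biggr)\\ &\quad+\frac{(-1)^{\mu+1}}{(\lambda-1)^{\mu+1}}\sum_{j=0}^{\mu-1}\left\langle{\mu\atop j}\right\rangle\lambda^{j+1}, \end{aligned} $$ where $$ D_{j,\ell}=\lambda^{jd}j^\ell=\left[\sum_{h=0}^\ell\left\{{\ell\atop h}\right\}x^h\frac{\mathrm{d}^h}{\mathrm{d}x^h}x^j\right]_{x=\lambda^d}. $$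
   Context: For positive integers $a_1,\dots,a_k$ with $\gcd(a_1,\dots,a_k)=1$, $\mathrm{NR}(a_1,\dots,a_k)$ denotes the (finite) set of positive integers that cannot be written as a nonnegative integer combination of $a_1,\dots,a_k$, and $s_\mu^{(\lambda)}(a_1,\dots,a_k):=\sum_{n\in \mathrm{NR}(a_1,\dots,a_k)}\lambda^n n^\mu$. The Bernoulli numbers $B_n$ are defined by $\frac{x}{e^x-1}=\sum_{n=0}^\infty B_n\frac{x^n}{n!}$ (so $B_1=-\frac12$). The Stirling numbers of the second kind are $\left\{{n\atop m}\right\}=\frac{1}{m!}\sum_{i=0}^m(-1)^i\binom{m}{i}(m-i)^n$, with $0^0=1$. The Eulerian numbers are $\left\langle{n\atop m}\right\rangle=\sum_{k=0}^{m}(-1)^k\binom{n+1}{k}(m-k+1)^n$; equivalently $\sum_{k=0}^\infty k^nx^k=\frac{1}{(1-x)^{n+1}}\sum_{m=0}^{n-1}\left\langle{n\atop m}\right\rangle x^{m+1}$ for $n\ge 1$. $\frac{\mathrm{d}^h}{\mathrm{d}x^h}$ denotes the $h$-th derivative with respect to $x$ (unrelated to the integer $d$). Empty sums are $0$. *)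

(* Defs.v *)
(* The complex numbers are R[i] for R : realType. *)
From HB Require Import structures.
From mathcomp Require Export all_boot all_order all_algebra.
From mathcomp Require Export complex.
From mathcomp Require Export boolp classical_sets functions cardinality fsbigop.
From mathcomp Require Export reals topology normedtype derive.

Set Implicit Arguments.
Unset Strict Implicit.
Unset Printing Implicit Defensive.

Export GRing.Theory Num.Theory.
Export numFieldNormedType.Exports.

Local Open Scope ring_scope.

Definition representable (k : nat) (A : 'I_k -> nat) (n : nat) : Prop :=
  exists c : 'I_k -> nat, n = (\sum_(i < k) c i * A i)%N.

Definition NR (k : nat) (A : 'I_k -> nat) : set nat :=
  [set n | (0 < n)%N /\ ~ representable A n]%classic.

(* The sum over n \in NR A is the finitely supported sum of fsbigop, which is
   the genuine sum here since NR A is finite when the A i are positive and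
   coprime. *)
Definition sylvester_sum (K : comNzRingType) (mu : nat) (lambda : K) (k : nat)
    (A : 'I_k -> nat) : K :=
  (\sum_(n \in NR A) lambda ^+ n * n%:R ^+ mu)%R.

Definition arith_prog (a d k : nat) : 'I_k -> nat := fun i => (a + i * d)%N.
Arguments arith_prog : clear implicits.

(* Formal power series over rat, given by their coefficient sequences. *)
Definition fps_mul (f g : nat -> rat) : nat -> rat :=
  fun n => \sum_(i < n.+1) f i * g (n - i)%N.
Definition fps_egf (u : nat -> rat) : nat -> rat := fun n => u n / n`!%:R.
Definition fps_one : nat -> rat := fun n => (n == 0%N)%:R.
Definition fps_X : nat -> rat := fun n => (n == 1%N)%:R.
Definition fps_exp : nat -> rat := fps_egf (fun=> 1).

(* x / (e^x - 1) = \sum_n B_n x^n / n!, with the denominator cleared because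
   e^x - 1 has no constant term, hence no inverse among power series. *)
Definition bernoulli_egf (B : nat -> rat) : Prop :=
  fps_mul (fun n => fps_exp n - fps_one n) (fps_egf B) =1 fps_X.

Lemma bernoulli_egfE (B : nat -> rat) :
  bernoulli_egf B <->
  forall n, fps_egf B n =
    fps_one n - \sum_(i < n) fps_egf B i / (n.+1 - i)`!%:R.
Proof.
have coefE n : fps_mul (fun n => fps_exp n - fps_one n) (fps_egf B) n.+1 =
    (\sum_(i < n) fps_egf B i / (n.+1 - i)`!%:R) + fps_egf B n.
  rewrite /fps_mul (reindex_inj rev_ord_inj) big_ord_recr big_ord_recr /=.
  rewrite !subnn (_ : n.+2 - n.+1 = 1)%N ?subSnn // subn1 /=.
  rewrite /fps_exp /fps_egf /fps_one /= fact0 !divr1 subrr mul0r addr0.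
  rewrite subr0 mul1r; congr (_ + _); apply: eq_bigr => i _ /=.
  have lin := ltnW (ltn_ord i).
  by rewrite !subSS subKn ?leqW // (subSn lin) /= subr0 mul1r mulrC.
split=> [h n|h [|n]].
- have := h n.+1; rewrite coefE /fps_X eqSS -/(fps_one n) => <-.
  by rewrite addrAC subrr add0r.
- by rewrite /fps_mul big_ord1 /fps_exp /fps_egf /fps_one divr1 subrr mul0r.
- by rewrite coefE h addrCA subrr addr0.
Qed.

Lemma bernoulli_egf_uniq (B B' : nat -> rat) :
  bernoulli_egf B -> bernoulli_egf B' -> B =1 B'.
Proof.
move=> /bernoulli_egfE hB /bernoulli_egfE hB'.
suff h n : fps_egf B n = fps_egf B' n.
  move=> n; have := h n; apply: mulIf.
  by rewrite invr_eq0 pnatr_eq0 -lt0n fact_gt0.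
elim/ltn_ind: n => n IH; rewrite hB hB'; congr (_ - _).
by apply: eq_bigr => i _; rewrite IH.
Qed.

Lemma bernoulli_egf_ex : {B : nat -> rat | bernoulli_egf B}.
Proof.
pose step (s : seq rat) : seq rat := rcons s
  (fps_one (size s) -
   \sum_(i < size s) nth 0 s i / ((size s).+1 - i)`!%:R).
pose L n := iter n step [::].
have sL n : size (L n) = n by elim: n => //= n IH; rewrite size_rcons IH.
pose b n := nth 0 (L n.+1) n.
have Lb n i : (i < n)%N -> nth 0 (L n) i = b i.
  elim: n => // n IH; rewrite ltnS leq_eqVlt => /orP[/eqP -> //|lin].
  by rewrite /L iterS -/(L n) nth_rcons sL lin IH.
exists (fun n => b n * n`!%:R); apply/bernoulli_egfE => n.
have bE m : fps_egf (fun n => b n * n`!%:R) m = b m.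
  by rewrite /fps_egf mulfK // pnatr_eq0 -lt0n fact_gt0.
rewrite bE {1}/b /L iterS -/(L n) nth_rcons sL ltnn eqxx; congr (_ - _).
by apply: eq_bigr => i _; rewrite Lb // bE.
Qed.

Definition bernoulli : nat -> rat := sval bernoulli_egf_ex.

Lemma bernoulliP : bernoulli_egf bernoulli.
Proof. exact: svalP bernoulli_egf_ex. Qed.

Definition stirling2 (n m : nat) : rat :=
  (m`!%:R)^-1 * \sum_(0 <= i < m.+1) (-1) ^+ i * 'C(m, i)%:R * (m - i)%N%:R ^+ n.

Definition eulerian (n m : nat) : int :=
  \sum_(0 <= k < m.+1) (-1) ^+ k * 'C(n.+1, k)%:R * (m - k + 1)%N%:R ^+ n.

Definition Dterm (K : comNzRingType) (lambda : K) (d j l : nat) : K :=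
  lambda ^+ (j * d) * j%:R ^+ l.

(* Main.v *)
Require Import Defs.
From mathcomp Require Import zify ring.

(** Put [w = k - 1]. A combination of [a, a + d, ..., a + w d] has the form
    [C a + J d] with [J <= C w]. For [j < a] the least representable number
    congruent to [j d] modulo [a] is thus [m_j = ceil (j / w) a + j d], and the
    nonrepresentable numbers of the class are its members below [m_j]
    ([representable_residue]). By coprimality these classes exhaust all residues
    modulo [a] ([residue_inj]).

    Let [F] be the polynomial with [F 0 = 0] and [F (x + a) - F x = x^mu] given
    by the Bernoulli numbers ([faulhaberD]). Since [lambda^a = 1], the weight
    [lambda^n] is constant on each class, and the sum over the class of [j d]
    telescopes to [lambda^(j d) (F m_j - F b_j)], where [b_j] is the residue of
    [j d] modulo [a].

    The values [F m_j], expanded by the binomial theorem, give the main double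
    sum; the ranges of [j] in it are the blocks on which [ceil (j / w)] is
    constant ([sum_ceil_blocks]).

    The residues [b_j] run through [0, ..., a - 1], so that the rest is minus the
    twisted sum [H 0], where [H x = \sum_(b < a) lambda^b F (x + b)]. This [H]
    solves [lambda H (x + 1) - H x = x^mu] and has degree at most [mu], because
    [\sum_(b < a) lambda^b = 0]. Such a solution has
    [- H 0 * (1 - lambda)^(mu + 1)] equal to the Eulerian polynomial
    ([eulerian_fdiff]), which yields the last term of the formula.

    The operator form of [Dterm] expresses that [x^h (d/dx)^h] multiplies [x^j]
    by a falling factorial, and that Stirling numbers expand [j^l] in falling
    factorials, which is Newton's interpolation formula for [x^l]
    ([sum_stirling2_ffact]). *)

Local Open Scope ring_scope.
Set Implicit Arguments.
Unset Strict Implicit.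
Unset Printing Implicit Defensive.

(** * Forward differences *)

Definition fdiff (V : zmodType) (u : nat -> V) : nat -> V :=
  fun n => u n.+1 - u n.

(** Pascal's rule in summed form: the induction step shared by the expansion of
    an iterated difference and by Newton's interpolation formula. *)
Lemma sum_binS (K : pzRingType) (n : nat) (f : nat -> K) :
  \sum_(i < n.+2) 'C(n.+1, i)%:R * f i =
  \sum_(i < n.+1) 'C(n, i)%:R * f i + \sum_(i < n.+1) 'C(n, i)%:R * f i.+1.
Proof.
rewrite big_ord_recl.
under eq_bigr do rewrite lift0 binS natrD mulrDl.
rewrite big_split /= addrA; congr (_ + _).
rewrite [X in _ + X = _]big_ord_recr /= (bin_small (ltnSn n)) mul0r addr0.
by rewrite [RHS]big_ord_recl !bin0.
Qed.

Lemma iter_fdiffE (K : comPzRingType) (h : nat) (u : nat -> K) (n : nat) :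
  iter h (@fdiff K) u n =
  \sum_(i < h.+1) (-1) ^+ i * 'C(h, i)%:R * u (n + (h - i))%N.
Proof.
have step (g : nat -> K) m : \sum_(i < m.+1) (-1) ^+ i * 'C(m, i)%:R * g i =
    \sum_(i < m.+1) 'C(m, i)%:R * ((-1) ^+ i * g i).
  by apply: eq_bigr => i _; rewrite [RHS]mulrCA mulrA.
elim: h n => [|h IH] n; first by rewrite big_ord1 bin0 subnn addn0 !mul1r.
rewrite iterS /fdiff !IH.
rewrite (step (fun i => u (n.+1 + (h - i))%N)) (step (fun i => u (n + (h - i))%N)).
rewrite (step (fun i => u (n + (h.+1 - i))%N)).
rewrite (sum_binS _ (fun i => (-1) ^+ i * u (n + (h.+1 - i))%N)); congr (_ + _).
  apply: eq_bigr => i _; rewrite addSnnS subSn //; exact: (ltn_ord i).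
rewrite -sumrN; apply: eq_bigr => i _.
by rewrite subSS exprS !mulN1r mulNr mulrN.
Qed.

(** Newton's formula: the shift is [1 + fdiff], expanded by the binomial
    theorem and applied at [0]. *)
Lemma newton_forward (K : comPzRingType) (u : nat -> K) (j : nat) :
  u j = \sum_(h < j.+1) 'C(j, h)%:R * iter h (@fdiff K) u 0%N.
Proof.
elim: j u => [|j IH] u; first by rewrite big_ord1 bin0 mul1r.
rewrite (sum_binS _ (fun h => iter h (@fdiff K) u 0%N)) -IH.
under eq_bigr => i _ do rewrite iterSr.
by rewrite -IH /fdiff addrC subrK.
Qed.

Lemma iter_fdiff_lin (K : comPzRingType) (m p : nat) (c : nat -> K)
    (u : nat -> nat -> K) (n : nat) :
  iter m (@fdiff K) (fun x => \sum_(i < p) c i * u i x) n =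
  \sum_(i < p) c i * iter m (@fdiff K) (u i) n.
Proof.
rewrite iter_fdiffE; under eq_bigr do rewrite mulr_sumr.
rewrite exchange_big; apply: eq_bigr => i _ /=.
rewrite iter_fdiffE mulr_sumr; apply: eq_bigr => j _.
by rewrite mulrCA.
Qed.

Lemma fdiff_expr (K : comPzRingType) (p n : nat) :
  fdiff (fun x => x%:R ^+ p : K) n = \sum_(i < p) 'C(p, i)%:R * n%:R ^+ i.
Proof.
rewrite /fdiff -natr1 [_ + 1]addrC exprDn.
rewrite big_ord_recr /= subnn binn mul1r mulr1n addrK; apply: eq_bigr => i _.
by rewrite expr1n mul1r mulr_natl.
Qed.

(** A difference lowers the degree of a power, so more differences than the
    degree leave nothing. *)
Lemma iter_fdiff_expr (K : comPzRingType) (m p n : nat) : (p < m)%N ->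
  iter m (@fdiff K) (fun x => x%:R ^+ p) n = 0.
Proof.
elim: m p n => // m IH p n ltpm; rewrite iterSr.
rewrite (_ : fdiff _ = fun x => \sum_(i < p) 'C(p, i)%:R * x%:R ^+ i); last first.
  by apply/funext => x; rewrite fdiff_expr.
rewrite (iter_fdiff_lin _ _ (fun i => 'C(p, i)%:R) (fun i x => x%:R ^+ i)).
rewrite big1 // => i _; rewrite IH ?mulr0 //.
by apply: leq_trans (ltn_ord i) _; rewrite -ltnS.
Qed.

(** * Stirling numbers and the operator [x^h (d/dx)^h] *)

(** The alternating sum defining the Stirling number is an iterated difference
    of [x^l] at [0]; Newton's formula for [x^l] then becomes the expansion of a
    power in falling factorials. *)
Lemma stirling2E (l h : nat) :
  stirling2 l h = (h`!%:R)^-1 * iter h (@fdiff rat) (fun x => x%:R ^+ l) 0%N.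
Proof. by rewrite /stirling2 iter_fdiffE big_mkord. Qed.

Lemma ratr_iter_fdiff (K : numFieldType) (u : nat -> rat) h n :
  ratr (iter h (@fdiff rat) u n) = iter h (@fdiff K) (fun x => ratr (u x)) n.
Proof. by elim: h n => // h IH n; rewrite !iterS /fdiff rmorphB /= !IH. Qed.

Lemma sum_stirling2_ffact (K : numFieldType) (l j : nat) :
  \sum_(h < l.+1) ratr (stirling2 l h) * (j ^_ h)%:R = j%:R ^+ l :> K.
Proof.
pose D h : K := iter h (@fdiff K) (fun x => x%:R ^+ l) 0%N.
have termE h : ratr (stirling2 l h) * (j ^_ h)%:R = 'C(j, h)%:R * D h.
  have powE : (fun x => ratr (x%:R ^+ l)) = (fun x => x%:R ^+ l) :> (nat -> K).
    by apply/funext => x; rewrite rmorphXn /= ratr_nat.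
  rewrite stirling2E rmorphM /= ratr_iter_fdiff powE fmorphV /= ratr_nat.
  rewrite -bin_ffact.
  by rewrite natrM -/(D h); field;
    rewrite pnatr_eq0 -lt0n fact_gt0.
under eq_bigr do rewrite termE.
rewrite (newton_forward (fun x => x%:R ^+ l : K)).
(* Newton's sum stops at j, Stirling's at l; the terms between the two bounds
   vanish, either because 'C(j, h) = 0 or because the difference does. *)
have ext n m : (n <= m)%N ->
    (forall h, (n <= h < m)%N -> 'C(j, h)%:R * D h = 0) ->
   \sum_(h < m) 'C(j, h)%:R * D h = \sum_(h < n) 'C(j, h)%:R * D h.
  move=> nm z; rewrite -!(big_mkord xpredT (fun h => 'C(j, h)%:R * D h)).
  rewrite (big_cat_nat (n := n)) //=.
  by rewrite [X in _ + X]big_nat_cond [X in _ + X]big1 ?addr0 // => i /andP[/z].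
have [lj|jl] := leqP l.+1 j.+1.
  rewrite [RHS](ext _ _ lj) // => h /andP[lh _].
  by rewrite /D iter_fdiff_expr ?mulr0.
by rewrite (ext _ _ (ltnW jl)) // => h /andP[lh _]; rewrite bin_small ?mul0r.
Qed.

Lemma derive1n_expr (K : numFieldType) (j h : nat) :
  derive1n h (fun y : K => (y ^+ j : K^o)) =
  fun y => (j ^_ h)%:R * y ^+ (j - h).
Proof.
elim: h => [|h IH]; first by apply/funext => y; rewrite derive1n0 subn0 mul1r.
rewrite derive1nS IH; apply/funext => y.
rewrite derive1Ml ?exp_derive1; last exact: exprn_derivable.
by rewrite ffactnSr natrM -subnS mulrA.
Qed.

(** Since [x^h (d/dx)^h] multiplies [x^j] by the falling factorial [j ^_ h],
    the Stirling expansion of [j^l] gives the operator form. *)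
Lemma Dterm_stirling (K : numFieldType) (lambda : K) (d j l : nat) :
  Dterm lambda d j l =
  \sum_(0 <= h < l.+1) ratr (stirling2 l h) * (lambda ^+ d) ^+ h *
     derive1n h (fun y : K => (y ^+ j : K^o)) (lambda ^+ d).
Proof.
rewrite big_mkord /Dterm -(sum_stirling2_ffact K) mulr_sumr mulnC exprM.
apply: eq_bigr => h _; rewrite derive1n_expr.
have [hj|jh] := leqP h j; last by rewrite ffact_small // !(mulr0, mul0r).
by rewrite -{1}(subnKC hj) exprD; ring.
Qed.

(** * Faulhaber's formula for arithmetic progressions *)

Lemma fact_neq0 (K : numDomainType) n : n`!%:R != 0 :> K.
Proof. by rewrite pnatr_eq0 -lt0n fact_gt0. Qed.

(** The coefficient of [x^m] in [(e^x - 1) * (x / (e^x - 1)) = x], scaled by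
    [m!]. *)
Lemma sum_bernoulli (m : nat) :
  \sum_(n < m) 'C(m, n)%:R * bernoulli n = (m == 1%N)%:R.
Proof.
have := bernoulliP m; rewrite /fps_mul (reindex_inj rev_ord_inj) big_ord_recr /=.
rewrite !subSS subnn /fps_exp /fps_one /fps_egf /= divr1 subrr mul0r addr0.
move/(congr1 (fun z => m`!%:R * z)); rewrite mulr_sumr => h.
transitivity (m`!%:R * fps_X m : rat); last first.
  by rewrite /fps_X; case: eqP => [->|_]; rewrite ?mulr1 ?mulr0.
rewrite -h; apply: eq_bigr => i _; rewrite subKn 1?ltnW ?ltnS //.
rewrite subSS subn_eq0 leqNgt ltn_ord subr0.
rewrite -(bin_fact (ltnW (ltn_ord i))) !natrM.
by field; rewrite !fact_neq0.
Qed.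

(** Both sides are the trinomial coefficient [M! / (n! p! (M - n - p)!)]. *)
Lemma mul_bin_bin (M n p : nat) : (n + p <= M)%N ->
  ('C(M, n) * 'C(M - n, p) = 'C(M, p) * 'C(M - p, n))%N.
Proof.
move=> npM; have f0 := fact_gt0.
have h1 : (n <= M)%N by lia.
have h2 : (p <= M)%N by lia.
have h3 : (p <= M - n)%N by lia.
have h4 : (n <= M - p)%N by lia.
apply/eqP; rewrite -(eqn_pmul2r (f0 n)) -(eqn_pmul2r (f0 p)).
rewrite -(eqn_pmul2r (f0 (M - n - p)%N)); apply/eqP.
have := bin_fact h1; rewrite -(bin_fact h3).
have := bin_fact h2; rewrite -(bin_fact h4).
by rewrite (subnAC M p n) => <-; lia.
Qed.

(** This is [a^mu / (mu + 1)] times the Bernoulli polynomial of index [mu + 1] at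
    [x / a], with its constant term dropped, so that it vanishes at [0]. *)
Definition faulhaber (K : numFieldType) (a : K) (mu : nat) (x : K) : K :=
  mu.+1%:R^-1 * \sum_(n < mu.+1)
    'C(mu.+1, n)%:R * ratr (bernoulli n) * a ^ (n%:Z - 1) * x ^+ (mu.+1 - n).

(** The difference equation of the Bernoulli polynomials. Expanding [(x + a)^m]
    and exchanging the sums, the coefficient of [x^p] becomes a sum of
    [sum_bernoulli], which leaves only [p = mu]. *)
Lemma faulhaberD (K : numFieldType) (a : K) (mu : nat) (x : K) : a != 0 ->
  faulhaber a mu (x + a) - faulhaber a mu x = x ^+ mu.
Proof.
move=> a0; rewrite /faulhaber -mulrBr -sumrB; set M := mu.+1.
have M0 : M%:R != 0 :> K by rewrite pnatr_eq0.
apply: (mulfI M0); rewrite mulVKf //.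
transitivity (\sum_(n < M) \sum_(p < M | (n + p < M)%N)
    x ^+ p * a ^+ (M - p - 1) * 'C(M, p)%:R * ('C(M - p, n)%:R * ratr (bernoulli n))).
  apply: eq_bigr => n _; rewrite -mulrBr.
  have -> : (x + a) ^+ (M - n) - x ^+ (M - n) =
      \sum_(p < M | (n + p < M)%N) a ^+ (M - n - p) * x ^+ p *+ 'C(M - n, p).
    rewrite [x + a]addrC exprDn big_ord_recr /= subnn mul1r binn mulr1n addrK.
    rewrite (big_ord_widen_cond M xpredT
      (fun p => a ^+ (M - n - p) * x ^+ p *+ 'C(M - n, p))).
      by apply: eq_bigl => p; rewrite /= ltn_subRL.
    exact: leq_subr.
  rewrite mulr_sumr; apply: eq_bigr => p npM.
  have -> : a ^+ (M - p - 1) = a ^ (n%:Z - 1) * a ^+ (M - n - p).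
    rewrite [X in _ * X]exprnP -expfzDr // exprnP; congr (a ^ _).
    by have := ltn_ord n; have := ltn_ord p; lia.
  have := congr1 (fun z => z%:R : K) (mul_bin_bin (ltnW npM)).
  rewrite !natrM => e; rewrite -mulr_natr.
  transitivity (x ^+ p * (a ^ (n%:Z - 1) * a ^+ (M - n - p)) *
    ('C(M, n)%:R * 'C(M - n, p)%:R) * ratr (bernoulli n)).
    by ring.
  by rewrite e; ring.
rewrite (exchange_big_dep xpredT) //=.
transitivity (\sum_(p < M) x ^+ p * a ^+ (M - p - 1) * 'C(M, p)%:R * (M - p == 1)%N%:R).
  apply: eq_bigr => p _; rewrite -mulr_sumr; congr (_ * _).
  rewrite -[RHS](ratr_nat K) -sum_bernoulli rmorph_sum /=.
  rewrite (big_ord_widen_cond M xpredT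
    (fun n => ratr ('C(M - p, n)%:R * bernoulli n))) ?leq_subr //.
  apply: eq_big => [n|n _]; first by rewrite /= ltn_subRL addnC.
  by rewrite rmorphM /= ratr_nat.
rewrite big_ord_recr big1 /= => [|p _].
  by rewrite add0r subSnn expr0 mulr1 binSn mulr1 mulrC.
by rewrite (_ : _ == _ = false) ?mulr0 //; have := ltn_ord p; lia.
Qed.

Lemma faulhaber_mul (K : numFieldType) (a : nat) (mu b T : nat) : (0 < a)%N ->
  \sum_(t < T) (b + t * a)%N%:R ^+ mu =
  faulhaber a%:R mu (b + T * a)%N%:R - faulhaber a%:R mu b%:R :> K.
Proof.
move=> a0.
have := telescope_sumr (fun t => faulhaber a%:R mu (b + t * a)%N%:R : K) (leq0n T).
rewrite mul0n addn0 => <-; rewrite big_mkord; apply: eq_bigr => t _.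
rewrite mulSnr addnA [X in faulhaber _ _ X - _]natrD faulhaberD //.
by rewrite pnatr_eq0 -lt0n.
Qed.

(** * Eulerian numbers and twisted sums over a full period *)

Lemma iter_fdiff_faulhaber (K : numFieldType) (a : K) (mu n : nat) :
  iter mu.+2 (@fdiff K) (fun x => faulhaber a mu x%:R) n = 0.
Proof.
pose c (n : nat) :=
  mu.+1%:R^-1 * ('C(mu.+1, n)%:R * ratr (bernoulli n) * a ^ (n%:Z - 1)).
have -> : (fun x : nat => faulhaber a mu x%:R) =
    fun x => \sum_(n < mu.+1) c n * x%:R ^+ (mu.+1 - n).
  apply/funext => x; rewrite /faulhaber mulr_sumr.
  by apply: eq_bigr => i _; rewrite mulrA.
rewrite (iter_fdiff_lin _ _ c (fun n x => x%:R ^+ (mu.+1 - n))).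
by rewrite big1 // => i _; rewrite iter_fdiff_expr ?mulr0 // ltnS leq_subr.
Qed.

(** If [lambda H(x + 1) - H(x) = x^mu], then [- H(0)] plays the part of the
    Abel sum of [lambda^n n^mu]: multiplying the series by
    [(1 - lambda)^(mu + 1)] yields the Eulerian polynomial. Here the product is
    carried out on finitely many terms; it telescopes, and the last term is the
    [(mu + 1)]-th difference of [H], which vanishes when [H] has degree at most
    [mu]. *)
Lemma eulerian_fdiff (K : numFieldType) (lambda : K) (mu : nat) (H : nat -> K) :
  (0 < mu)%N ->
  (forall n, lambda * H n.+1 - H n = n%:R ^+ mu) ->
  iter mu.+1 (@fdiff K) H 0%N = 0 ->
  \sum_(j < mu) (eulerian mu j)%:~R * lambda ^+ j.+1 =
  - (1 - lambda) ^+ mu.+1 * H 0%N.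
Proof.
move=> mu0 recH; rewrite iter_fdiffE => top0; set M := mu.+1 in top0 *.
pose s k : K := (-1) ^+ k * 'C(M, k)%:R.
pose c m := \sum_(k < m.+1) s k * H (m - k)%N.
have stepc m : \sum_(k < m.+1) s k * (m - k)%N%:R ^+ mu =
    lambda * (c m.+1 - s m.+1 * H 0%N) - c m.
  rewrite /c [in RHS]big_ord_recr /= subnn addrK mulr_sumr -sumrB.
  apply: eq_bigr => k _; rewrite subSn; last exact: (ltn_ord k).
  by rewrite -recH; ring.
have eulE j : (eulerian mu j)%:~R = \sum_(k < j.+2) s k * (j.+1 - k)%N%:R ^+ mu.
  rewrite big_ord_recr /= subnn expr0n gtn_eqF // mulr0 addr0.
  rewrite /eulerian big_mkord rmorph_sum /=; apply: eq_bigr => k _.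
  rewrite !rmorphM /= !rmorphXn /= rmorphN rmorph1 !mulrz_nat.
  by rewrite addn1 subSn //; exact: (ltn_ord k).
(* The term m = 0 vanishes since mu > 0; this accounts for the exponent j + 1
   of lambda next to the Eulerian number of index j. *)
transitivity (\sum_(m < M) lambda ^+ m * (\sum_(k < m.+1) s k * (m - k)%N%:R ^+ mu)).
  rewrite big_ord_recl big_ord1 /= subnn [0 ^+ _]expr0n gtn_eqF // !mulr0 add0r.
  by apply: eq_bigr => j _; rewrite eulE mulrC.
transitivity (\sum_(m < M) (lambda ^+ m.+1 * c m.+1 - lambda ^+ m * c m)
    - (\sum_(m < M) lambda ^+ m.+1 * s m.+1) * H 0%N).
  rewrite mulr_suml -sumrB; apply: eq_bigr => m _.
  by rewrite stepc exprS; ring.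
rewrite -(big_mkord xpredT (fun m => lambda ^+ m.+1 * c m.+1 - lambda ^+ m * c m)).
rewrite telescope_sumr // (_ : c M = 0); last first.
  by rewrite -top0; apply: eq_bigr => k _; rewrite add0n.
rewrite /c big_ord1 [in RHS]exprDn [in RHS]big_ord_recl /s /= !expr0 bin0 expr1n.
rewrite (_ : \sum_(m < M) _ = \sum_(i < M)
    1 ^+ (M - bump 0 i) * (- lambda) ^+ bump 0 i *+ 'C(M, bump 0 i)).
  by rewrite subnn mulr1n; ring.
apply: eq_bigr => i _; rewrite expr1n mul1r [bump 0 i]add1n.
by rewrite [in RHS]exprNn -[RHS]mulr_natr; ring.
Qed.

(** Write [F] for the Faulhaber polynomial and
    [H(x) = \sum_(b < a) lambda^b F(x + b)]. As [lambda^a = 1], the combination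
    [lambda H(x + 1) - H(x)] telescopes to [F(x + a) - F(x) = x^mu]. The
    [(mu + 1)]-th difference of [F] is a constant, so that of [H] is this
    constant times [\sum_(b < a) lambda^b = 0]. The value of [H] at [0] is
    therefore given by [eulerian_fdiff]. *)
Lemma sum_faulhaber_eulerian (K : numFieldType) (lambda : K) (a mu : nat) :
  (0 < a)%N -> (0 < mu)%N -> lambda ^+ a = 1 -> lambda != 1 ->
  \sum_(b < a) lambda ^+ b * faulhaber a%:R mu b%:R =
  - ((1 - lambda) ^+ mu.+1)^-1 *
    \sum_(j < mu) (eulerian mu j)%:~R * lambda ^+ j.+1.
Proof.
move=> a0 mu0 la l1; have l10 : 1 - lambda != 0 by rewrite subr_eq0 eq_sym.
pose F n : K := faulhaber a%:R mu n%:R.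
pose H n := \sum_(b < a) lambda ^+ b * F (n + b)%N.
rewrite (@eulerian_fdiff _ _ _ H) //.
- by rewrite !mulNr mulrN opprK mulKf ?expf_neq0.
- move=> n; rewrite /H mulr_sumr; case: a a0 la @F @H => // a' _ la F H.
  rewrite big_ord_recr big_ord_recl /=.
  under eq_bigr do rewrite addSnnS mulrA -exprS.
  rewrite mulrA -exprS la expr0 !mul1r addn0.
  rewrite [X in X - _]addrC [X in _ - X]addrC addrKA /F.
  rewrite addSnnS -[RHS](@faulhaberD _ a'.+1%:R) ?pnatr_eq0 //.
  by rewrite -natrD.
- have const n : iter mu.+1 (@fdiff K) F n = iter mu.+1 (@fdiff K) F 0%N.
    elim: n => // n <-; apply/eqP; rewrite -subr_eq0; apply/eqP.
    exact: (iter_fdiff_faulhaber a%:R mu n).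
  have shift m b n :
      iter m (@fdiff K) (fun x => F (x + b)%N) n = iter m (@fdiff K) F (n + b)%N.
    by elim: m n => // m IH n; rewrite !iterS /fdiff !IH.
  rewrite (iter_fdiff_lin _ _ (fun b => lambda ^+ b) (fun b x => F (x + b)%N)).
  under eq_bigr do rewrite shift const.
  rewrite -mulr_suml (_ : \sum_(b < a) _ = 0) ?mul0r //.
  have : lambda - 1 != 0 by rewrite subr_eq0.
  by move/mulfI; apply; rewrite -subrX1 la subrr mulr0.
Qed.

(** * Representable numbers and their residue classes *)

(** A combination [\sum_i c_i (a + i d)] only depends on [C = \sum_i c_i] and
    [J = \sum_i i c_i], and the constraint on these is [J <= C w]: a number up
    to [C w] is a sum of [C] parts of size at most [w], taken greedily. *)
Lemma representable_arith_progP (a d w n : nat) :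
  representable (arith_prog a d w.+1) n <->
  exists C J, (J <= C * w)%N /\ n = (C * a + J * d)%N.
Proof.
split=> [[c ->]|[C [J [JC ->]]]].
  exists (\sum_(i < w.+1) c i)%N, (\sum_(i < w.+1) c i * i)%N; split.
    rewrite big_distrl leq_sum // => i _; rewrite leq_mul2l -ltnS ltn_ord.
    by rewrite orbT.
  rewrite !big_distrl -big_split; apply: eq_bigr => i _ /=.
  by rewrite /arith_prog mulnDr mulnA.
elim: C J JC => [|C IH] J JC.
  exists (fun=> 0%N); rewrite big1 //; move: JC; rewrite mul0n leqn0 => /eqP->.
  by rewrite !mul0n.
(* The greedy part: as large as J and w permit. *)
pose i0 : 'I_w.+1 := inord (minn J w).
have i0E : nat_of_ord i0 = minn J w by rewrite inordK // ltnS geq_minr.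
have [|c cE] := IH (J - minn J w)%N; first by rewrite mulSn in JC; lia.
exists (fun i => (c i + (i == i0))%N).
under eq_bigr do rewrite mulnDl.
rewrite big_split /=.
have -> : (\sum_(i < w.+1) (i == i0) * arith_prog a d w.+1 i = a + i0 * d)%N.
  rewrite (bigD1 i0) //= eqxx mul1n big1 ?addn0 // => i /negbTE->.
  by rewrite mul0n.
rewrite -cE i0E mulSn -{1}(subnK (geq_minl J w)) mulnDl; lia.
Qed.

Definition ceil_div (w j : nat) : nat := (j + w.-1) %/ w.

Definition least_rep (a d w j : nat) : nat := (ceil_div w j * a + j * d)%N.

Lemma ceil_div_le (w j C : nat) : (0 < w)%N ->
  (ceil_div w j <= C)%N = (j <= C * w)%N.
Proof.
move=> w0; rewrite /ceil_div -ltnS ltn_divLR // mulSn; apply/idP/idP; lia.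
Qed.

Lemma least_rep_mod (a d w j : nat) : least_rep a d w j = (j * d)%N %[mod a].
Proof. by rewrite /least_rep modnMDl. Qed.

(** A representable number in the class of [j d] uses some [J] congruent to [j]
    modulo [a], hence [J >= j], and at least [ceil (j / w)] generators. Adding
    copies of [a] to the least one reaches all larger members of the class. *)
Lemma representable_residue (a d w j n : nat) :
  (0 < a)%N -> (0 < w)%N -> coprime a d -> (j < a)%N ->
  n = (j * d)%N %[mod a] ->
  representable (arith_prog a d w.+1) n <-> (least_rep a d w j <= n)%N.
Proof.
move=> a0 w0 cad ja nj; rewrite representable_arith_progP.
split=> [[C [J [JC nE]]]|len].
  have jJ : (j <= J)%N.
    rewrite leqNgt; apply/negP => Jj.
    have : (j * d == J * d %[mod a])%N by rewrite -nj nE modnMDl.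
    rewrite eqn_mod_dvd ?leq_mul2r ?(ltnW Jj) ?orbT // -mulnBl Gauss_dvdl //.
    by move/dvdn_leq; lia.
  by rewrite nE leq_add ?leq_mul ?ceil_div_le ?(leq_trans jJ).
exists (ceil_div w j + (n - least_rep a d w j) %/ a)%N, j.
split; first by rewrite -ceil_div_le // leq_addr.
have dv : (a %| n - least_rep a d w j)%N.
  by rewrite -eqn_mod_dvd // nj least_rep_mod.
by rewrite mulnDl addnAC -/(least_rep a d w j) divnK // subnKC.
Qed.

(** * The Sylvester sum by residue classes *)

Lemma sum_blocks (V : nmodType) (T a : nat) (g : nat -> V) :
  \sum_(0 <= n < T * a) g n = \sum_(t < T) \sum_(b < a) g (b + t * a)%N.
Proof.
elim: T => [|T IH]; first by rewrite big_ord0 big_geq.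
rewrite big_ord_recr /= -IH mulSnr (big_cat_nat (n := T * a)) ?leq_addr //=.
by congr (_ + _); rewrite -{1}[(T * a)%N]add0n big_addn addKn big_mkord.
Qed.

Definition residue (a d w : nat) (a0 : (0 < a)%N) (j : 'I_a) : 'I_a :=
  Ordinal (ltn_pmod (least_rep a d w j) a0).

Lemma residue_inj (a d w : nat) (a0 : (0 < a)%N) :
  coprime a d -> injective (residue d w a0).
Proof.
move=> cad.
move=> i j /(congr1 val) /=; rewrite !least_rep_mod => ij; apply/val_inj.
wlog lij : i j ij / (i <= j)%N.
  by move=> W; case: (leqP i j) => [|/ltnW] /W; [apply|move=> ->].
have /eqP := esym ij.
rewrite eqn_mod_dvd ?leq_mul2r ?lij ?orbT // -mulnBl Gauss_dvdl //.
have ja := ltn_ord j; case: (posnP (j - i)) => [ji _ | p0 /(dvdn_leq p0) aj].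
  by apply/eqP; rewrite eqn_leq lij -subn_eq0 ji.
by move: (leq_trans ja aj); rewrite ltnNge leq_subr.
Qed.

(** In the class of [j d] the nonrepresentable numbers are the members below
    [least_rep j], and [lambda^n] is constant there. The number [0], which is
    representable, may be included because its term [0^mu] vanishes. *)
Lemma sylvester_sum_residues (K : comNzRingType) (mu : nat) (lambda : K)
    (a d w : nat) :
  (0 < a)%N -> (0 < w)%N -> (0 < mu)%N -> coprime a d -> lambda ^+ a = 1 ->
  sylvester_sum mu lambda (arith_prog a d w.+1) =
  \sum_(j < a) lambda ^+ (j * d) *
    \sum_(t < least_rep a d w j %/ a)
       (least_rep a d w j %% a + t * a)%N%:R ^+ mu.
Proof.
move=> a0 w0 mu0 cad la; set m := least_rep a d w; set A := arith_prog _ _ _.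
pose g n : K := if n \in NR A then lambda ^+ n * n%:R ^+ mu else 0.
(* T * a bounds every nonrepresentable number. *)
pose T := (\sum_(j < a) m j)%N.
pose res := residue d w a0.
have mT (j : 'I_a) : (m j <= T)%N by rewrite /T (bigD1 j) //= leq_addr.
have res_inj : injective res by exact: residue_inj.
have gE (j : 'I_a) t : g (res j + t * a)%N =
    if (t < m j %/ a)%N then lambda ^+ (j * d) * (res j + t * a)%N%:R ^+ mu else 0.
  have nj : (res j + t * a)%N = (j * d)%N %[mod a].
    by rewrite addnC modnMDl /= modn_mod least_rep_mod.
  have lamE : lambda ^+ (res j + t * a) = lambda ^+ (j * d).
    by rewrite (divn_eq (res j + t * a) a) (divn_eq (j * d) a) nj !exprD
      ![(_ * a)%N]mulnC !exprM la !expr1n.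
  have lt_t : (t < m j %/ a)%N = (res j + t * a < m j)%N.
    by rewrite [in RHS](divn_eq (m j) a) addnC ltn_add2r ltn_pmul2r.
  have repE := representable_residue a0 w0 cad (ltn_ord j) nj.
  rewrite /g lt_t lamE ltnNge; case: (posnP (res j + t * a)%N) => [->|n0].
    by rewrite expr0n gtn_eqF // mulr0; do 2!case: ifP.
  case: ifP => [|/negP]; rewrite inE /NR /= => h.
    by case: leqP => // /repE; case: h.
  case: leqP => // lt_m; case: h; split=> //.
  by rewrite repE; apply/negP; rewrite -ltnNge.
have -> : sylvester_sum mu lambda A = \sum_(0 <= n < T * a) g n.
  rewrite /sylvester_sum -(fsbig_fwiden _ (NR A) g) //.
  - by apply: eq_fsbigr => n nN; rewrite /g nN.
  - move=> n nN; rewrite /= mem_index_iota /=.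
    have [j nj] : exists j : 'I_a, (n %% a)%N = res j.
      have [h _ hK] := injF_bij res_inj.
      by exists (h (Ordinal (ltn_pmod n a0))); rewrite hK.
    have nj' : n = (j * d)%N %[mod a] by rewrite nj /= least_rep_mod.
    case: nN => _; rewrite (representable_residue a0 w0 cad (ltn_ord j) nj').
    move/negP; rewrite -ltnNge => /leq_trans; apply.
    by apply: leq_trans (mT j) _; rewrite leq_pmulr.
  - exact: iota_uniq.
  - by move=> n [_ nN] /=; rewrite /g; case: ifP => // /set_mem.
rewrite sum_blocks exchange_big (reindex_inj res_inj) /=.
apply: eq_bigr => j _; under eq_bigr do rewrite gE.
rewrite mulr_sumr (big_ord_widen_cond T xpredT
  (fun t => lambda ^+ (j * d) * (m j %% a + t * a)%N%:R ^+ mu)).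
  by rewrite [RHS]big_mkcond.
exact: leq_trans (leq_div _ _) (mT j).
Qed.

(** [ceil_div w j] takes the value [s] exactly on the [s]-th block of length [w];
    the range of [j] consists of [q] such blocks and [r] more indices. *)
Lemma sum_ceil_blocks (K : pzSemiRingType) (w q r : nat) (U V : nat -> K) :
  (0 < w)%N -> (r < w)%N ->
  \sum_(1 <= s < q.+1) U s * (\sum_((s - 1) * w + 1 <= j < (s * w).+1) V j) +
  U q.+1 * (\sum_(q * w + 1 <= j < (q * w + r).+1) V j) =
  \sum_(1 <= j < (q * w + r).+1) U (ceil_div w j) * V j.
Proof.
move=> w0 rw.
have blockE s n : (n <= s.+1 * w)%N ->
    U s.+1 * (\sum_(s * w + 1 <= j < n.+1) V j) =
    \sum_(s * w + 1 <= j < n.+1) U (ceil_div w j) * V j.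
  move=> ns; rewrite mulr_sumr; apply: eq_big_nat => j /andP[sj jn].
  congr (U _ * _); apply/eqP; rewrite eqn_leq ltnNge !ceil_div_le //; lia.
rewrite blockE ?mulSn; last by lia.
suff -> : \sum_(1 <= s < q.+1) U s * (\sum_((s - 1) * w + 1 <= j < (s * w).+1) V j)
   = \sum_(1 <= j < q * w + 1) U (ceil_div w j) * V j.
  by rewrite -big_cat_nat //; lia.
elim: q => [|q IH]; first by rewrite !big_geq.
rewrite big_nat_recr //= IH subSS subn0 blockE // -big_cat_nat ?addn1 //; lia.
Qed.

(** * The weighted Sylvester sum *)

(** The binomial expansion of [(e a + j d)^(mu + 1 - n)] inside the Faulhaber
    polynomial. *)
Lemma faulhaber_combination (K : numFieldType) (a d mu : nat) (I : Type)
    (js : seq I) (e j : I -> nat) (c : I -> K) :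
  \sum_(i <- js) c i * faulhaber a%:R mu (e i * a + j i * d)%N%:R =
  mu.+1%:R^-1 * \sum_(n < mu.+1)
    'C(mu.+1, n)%:R * ratr (bernoulli n) * a%:R ^ (n%:Z - 1) *
    \sum_(l < (mu.+1 - n).+1) 'C(mu.+1 - n, l)%:R * d%:R ^+ l *
      \sum_(i <- js) (e i * a)%N%:R ^+ (mu.+1 - n - l) * (c i * (j i)%:R ^+ l).
Proof.
rewrite /faulhaber; under eq_bigr do rewrite mulrCA mulr_sumr.
rewrite -mulr_sumr exchange_big /=; congr (_ * _); apply: eq_bigr => n _.
under eq_bigr do rewrite mulrCA natrD exprDn mulr_sumr.
rewrite -mulr_sumr exchange_big /=; congr (_ * _); apply: eq_bigr => l _.
rewrite mulr_sumr; apply: eq_bigr => i _.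
by rewrite -mulr_natr [(j i * d)%N%:R]natrM exprMn; ring.
Qed.

(** The sum over each class is a difference of two Faulhaber values. The lower
    ends of the classes run through all residues modulo [a] and contribute the
    Eulerian term; the upper ends give the sum over [j]. *)
Lemma sylvester_sum_faulhaber (K : numFieldType) (mu : nat) (lambda : K)
    (a d w : nat) :
  (0 < a)%N -> (0 < w)%N -> (0 < mu)%N -> coprime a d ->
  lambda ^+ a = 1 -> lambda != 1 ->
  sylvester_sum mu lambda (arith_prog a d w.+1) =
  \sum_(1 <= j < a) lambda ^+ (j * d) *
    faulhaber a%:R mu (ceil_div w j * a + j * d)%N%:R +
  ((1 - lambda) ^+ mu.+1)^-1 *
    \sum_(j < mu) (eulerian mu j)%:~R * lambda ^+ j.+1.
Proof.
move=> a0 w0 mu0 cad la l1; rewrite sylvester_sum_residues //.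
under eq_bigr do rewrite faulhaber_mul // addnC -divn_eq mulrBr.
rewrite sumrB; congr (_ + _).
  rewrite -(big_mkord xpredT
    (fun j => lambda ^+ (j * d) * faulhaber a%:R mu (least_rep a d w j)%:R)).
  (* For j = 0 the least representable number is 0, where faulhaber vanishes. *)
  rewrite big_ltn // [X in X + _](_ : _ = 0) ?add0r //.
  rewrite /least_rep (_ : ceil_div w 0 = 0%N); last first.
    by apply/eqP; rewrite -leqn0 ceil_div_le.
  rewrite /faulhaber big1 ?mulr0 // => i _.
  by rewrite expr0n subn_eq0 leqNgt ltn_ord mulr0.
rewrite -[RHS]opprK -mulNr -(sum_faulhaber_eulerian a0) //; congr (- _).
rewrite [RHS](reindex_inj (@residue_inj a d w a0 cad)) /=.
apply: eq_bigr => j _; congr (_ * _).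
rewrite [in LHS](divn_eq (j * d) a) exprD mulnC exprM la expr1n mul1r.
by rewrite least_rep_mod.
Qed.

Theorem theorem6 (R : realType) (a d k q r : nat) (lambda : R[i]) (mu : nat)
  (ha : (0 < a)%N) (hd : (0 < d)%N) (had : coprime a d)
  (hk : (2 <= k <= a)%N)
  (hqr : (a - 1 = q * (k - 1) + r)%N) (hr : (r < k - 1)%N)
  (hlambda0 : lambda != 0) (hlambdaa : lambda ^+ a = 1)
  (hlambdad : lambda ^+ d != 1) (hmu : (0 < mu)%N) :
  sylvester_sum mu lambda (arith_prog a d k) =
    (mu + 1)%N%:R^-1 *
      (\sum_(0 <= n < mu.+1)
        'C(mu + 1, n)%:R * ratr (bernoulli n) * a%:R ^ (n%:Z - 1) *
        \sum_(0 <= l < (mu + 1 - n).+1)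
          'C(mu + 1 - n, l)%:R * d%:R ^+ l *
          (\sum_(1 <= s < q.+1)
             (s * a)%N%:R ^+ (mu + 1 - n - l) *
             (\sum_((s - 1) * (k - 1) + 1 <= j < (s * (k - 1)).+1)
                Dterm lambda d j l)
           + ((q + 1) * a)%N%:R ^+ (mu + 1 - n - l) *
             (\sum_(q * (k - 1) + 1 <= j < (q * (k - 1) + r).+1)
                Dterm lambda d j l)))
    + (-1) ^+ (mu + 1) / (lambda - 1) ^+ (mu + 1) *
      (\sum_(0 <= j < mu) (eulerian mu j)%:~R * lambda ^+ (j + 1))
  /\
  (forall j l : nat,
    Dterm lambda d j l =
    (fun x : R[i] =>
       \sum_(0 <= h < l.+1)
         ratr (stirling2 l h) * x ^+ h *
         derive1n h (fun y : R[i] => (y ^+ j : R[i]^o)) x) (lambda ^+ d)).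
Proof.
split; last by move=> j l; rewrite /= Dterm_stirling.
have l1 : lambda != 1.
  by apply: contra_neq hlambdad => ->; rewrite expr1n.
case: k hk hqr hr => // w /andP[w0 _]; rewrite !subSS !subn0 => hqr hr.
have aE : (q * w + r).+1 = a by rewrite -hqr subn1 prednK.
rewrite (sylvester_sum_faulhaber ha w0 hmu had hlambdaa l1).
rewrite !addn1; congr (_ + _).
  rewrite faulhaber_combination big_mkord; congr (_ * _).
  apply: eq_bigr => n _; rewrite big_mkord; congr (_ * _).
  apply: eq_bigr => l _; congr (_ * _).
  rewrite -[(q * w).+1]addn1 /Dterm.
  rewrite (sum_ceil_blocks q (fun s => (s * a)%N%:R ^+ (mu.+1 - n - l))
    (fun j => lambda ^+ (j * d) * j%:R ^+ l)) // aE.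
  by [].
rewrite big_mkord; congr (_ * _); last by apply: eq_bigr => j _; rewrite addn1.
by rewrite -[1 - lambda]opprB (exprNn (lambda - 1)) invfM invr_sign.
Qed.
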